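(* Let $(X,L)$ be a toric polarized manifold of dimension $n$ (a smooth projective toric variety with an ample line bundle $L=\mathcal{O}_X(D)$, $D$ torus-invariant), and let $P\subset M_{\mathbb{R}}$ be the associated polytope with vertices $x_{\sigma_1},\dots,x_{\sigma_l}$ corresponding, respectively, to the torus-fixed points $p_1,\dots,p_l$. Then for any choice of $R\le l$ different points $p_{i_1},\dots,p_{i_R}$ among $p_1,\dots,p_l$ there exists a subdivision of $P$ into $R$ polytopes $P_1,\dots,P_R$ (not necessarily lattice polytopes) such that $$\phi_{\mathbb{R}^n,j}(P_j)=\Delta_j(L)\qquad (j=1,\dots,R)$$ for a suitable choice of a family of valuations associated to infinitesimal (toric) flags centered at $p_{i_1},\dots,p_{i_R}$, where $\Delta_j(L)$ is the multipoint Okounkov body of $L$ at $p_{i_j}$ (with respect to the points $p_{i_1},\dots,p_{i_R}$).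
   Context: $M$ is the character lattice and $N=\mathrm{Hom}(M,\mathbb{Z})$ the dual lattice; for $D=\sum_\rho a_\rho D_\rho$ the polytope is $P=\{m\in M_{\mathbb{R}}:\langle m,v_\rho\rangle\ge -a_\rho\ \forall\rho\}$, $v_\rho$ the primitive generators of the rays of the fan. Vertices of $P$ correspond to torus-fixed points. Map $\phi_{\mathbb{R}^n,j}$: at the fixed point $p_{i_j}$ let $v_{j,1},\dots,v_{j,n}$ be the primitive generators of the rays of the maximal cone corresponding to $p_{i_j}$, associated with the invariant divisors $D_{j,1},\dots,D_{j,n}$ through $p_{i_j}$. After normalizing $D$ so that it is trivial near $p_{i_j}$ (i.e. translating $P$ so that the vertex $x_{\sigma_{i_j}}$ becomes the origin), $\phi_{\mathbb{R}^n,j}$ is the linear map $m\mapsto(\langle m,v_{j,1}\rangle,\dots,\langle m,v_{j,n}\rangle)$; equivalently $\phi_{\mathbb{R}^n,j}(m)=(\langle m-x_{\sigma_{i_j}},v_{j,a}\rangle)_{a=1}^n$. Infinitesimal toric flags: take local coordinates $z_{j,1},\dots,z_{j,n}$ centered at $p_{i_j}$ with $\{z_{j,a}=0\}=D_{j,a}$ locally; the associated valuation $\nu^{p_{i_j}}$ of a section $s=ft^k\in H^0(X,kL)$ ($t$ a local trivializing section of $L$) is the smallest exponent $\alpha$ with nonzero coefficient in $f=\sum a_\alpha z_j^\alpha$, for the deglex order ($\alpha<\beta$ iff $|\alpha|<|\beta|$, or $|\alpha|=|\beta|$ and $\alpha<_{lex}\beta$). Multipoint Okounkov bodies: writing $q_j=p_{i_j}$,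 $V_{k,j}:=\{s\in H^0(X,kL)\setminus\{0\}:\nu^{q_j}(s)<\nu^{q_i}(s)\ \forall i\ne j\}$ and $\Delta_j(L):=\overline{\bigcup_{k\ge1}\frac1k\nu^{q_j}(V_{k,j})}\subset\mathbb{R}^n$. Subdivision: $P=\bigcup_jP_j$ with the $P_j$ having pairwise disjoint interiors. *)

(* Defs.v *)
From HB Require Import structures.
From mathcomp Require Import all_boot all_order all_algebra.
From mathcomp Require Import all_classical all_reals all_analysis.
From mathcomp Require Import complex.
(* the notations of mpoly clash with those of mathcomp-analysis *)
From mathcomp Require Import(canonicals, coercions) mpoly.

Set Implicit Arguments.
Unset Strict Implicit.
Unset Printing Implicit Defensive.

Import Order.TTheory GRing.Theory Num.Theory.
Import numFieldNormedType.Exports.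

Local Open Scope classical_set_scope.
Local Open Scope ring_scope.

(* N = M = Z^n (row vectors of integers), the duality pairing between them
   being the dot product; likewise M_R = N_R = K^n for a real field K. *)
Definition pairing (A : pzRingType) (n : nat) (m v : 'rV[A]_n) : A :=
  \sum_(i < n) m 0 i * v 0 i.

Definition toReal (K : realType) (n : nat) (m : 'rV[int]_n) : 'rV[K]_n :=
  map_mx intr m.
Arguments toReal K {n} m.

(* A complete fan is given by its rays, by their generators, and by its maximal
   cones, which are n-dimensional; each cone is given by the set of its rays. *)
Record fan (n : nat) := Fan {
  ray : finType;
  gen : ray -> 'rV[int]_n;
  maxcones : {set {set ray}} }.

Definition cone (K : realType) n (F : fan n) (S : {set ray F}) :
    set 'rV[K]_n :=
  [set x | exists c : ray F -> K, (forall r, 0 <= c r) /\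
           x = \sum_(r in S) c r *: toReal K (gen r)].
Arguments cone K {n F} S.

(* The chart U_sigma = Spec C[sigma^dual :&: M] of a smooth maximal cone sigma
   is an affine space, with one coordinate for each ray of sigma.  A [chart] is
   a maximal cone together with an enumeration of its rays, so that the charts
   centered at the torus-fixed point p_sigma are the possible infinitesimal
   toric flags at p_sigma: {z_a = 0} is the divisor of the ray [e a]. *)
Definition is_chart n (F : fan n) (e : {ffun 'I_n -> ray F}) : bool :=
  injectiveb e && ([set e a | a : 'I_n]%SET \in maxcones F).

Record chart n (F : fan n) := Chart {
  chart_ray :> {ffun 'I_n -> ray F};
  chartP : is_chart chart_ray }.

(* The maximal cone of a chart; the torus-fixed point at its origin is identified
   with this cone. *)
Definition chart_cone n (F : fan n) (e : chart F) : {set ray F} :=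
  [set e a | a : 'I_n]%SET.

Definition gens n (F : fan n) (e : chart F) : 'M[int]_n :=
  \matrix_(a < n) gen (e a).

Definition smooth_complete_fan (K : realType) n (F : fan n) : Prop :=
  [/\ (forall S, S \in maxcones F -> #|S| = n),
      (forall e : chart F, gens e \in unitmx),
      (forall r : ray F, exists2 S, S \in maxcones F & r \in S),
      (forall S T, S \in maxcones F -> T \in maxcones F ->
         cone K S `&` cone K T = cone K (S :&: T)%SET) &
      (forall x : 'rV[K]_n, exists2 S, S \in maxcones F & cone K S x)].
Arguments smooth_complete_fan K {n} F.

(* the dual basis of (gen (e a))_a *)
Definition dual_gen n (F : fan n) (e : chart F) (b : 'I_n) : 'rV[int]_n :=
  row b (invmx (gens e)^T).

(* The value of the character chi^m at the point of U_e with coordinates z: the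
   coordinate z_a is chi^(dual_gen e a). *)
Definition chi (K : realType) n (F : fan n) (e : chart F) (m : 'rV[int]_n)
    (z : 'I_n -> K[i]) : K[i] :=
  \prod_(a < n) z a ^ pairing m (gen (e a)).

(* Two points of the disjoint union of the charts are identified in X iff they
   have the same image in U_(sigma :&: tau), the open subset of U_sigma where
   the coordinates of the rays outside tau do not vanish. The convention
   0 ^ 0 = 1 makes chi correct there, since the exponents at the coordinates
   which may vanish are nonnegative. *)
Definition glued (K : realType) n (F : fan n) (e : chart F) (z : 'I_n -> K[i])
    (e' : chart F) (w : 'I_n -> K[i]) : Prop :=
  (forall a, e a \notin chart_cone e' -> z a != 0) /\
  (forall b, w b = chi e (dual_gen e' b) z).

(* The Cartier datum of D = sum_r D r * D_r: the unique x in M such that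
   <x, gen r> = - D r for all the rays r of the cone of e. *)
Definition vertex n (F : fan n) (D : ray F -> int) (e : chart F) :
    'rV[int]_n :=
  (\row_(a < n) - D (e a)) *m invmx (gens e)^T.

(* A section of O(kD) over X, trivialised over U_e by the rational section
   chi^(k x_e); its local expressions are polynomials in the coordinates. *)
Definition is_section (K : realType) n (F : fan n) (D : ray F -> int)
    (k : nat) (s : chart F -> mpoly.mpoly n K[i]) : Prop :=
  forall (e e' : chart F) z w, glued e z e' w ->
    mpoly.meval w (s e') =
    chi e ((vertex D e - vertex D e') *+ k) z * mpoly.meval z (s e).

(* O(kD) is very ample: the map x |-> [s |-> s(x)] from X to the projective
   space of the dual of H^0(X, O(kD)) is defined everywhere, injective, and an
   immersion. *)
Definition very_ample (K : realType) n (F : fan n) (D : ray F -> int)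
    (k : nat) : Prop :=
  [/\ (forall (e : chart F) (z : 'I_n -> K[i]), exists2 s,
         is_section D k s & mpoly.meval z (s e) != 0),
      (forall (e e' : chart F) (z w : 'I_n -> K[i]) (c : K[i]), c != 0 ->
         (forall s, is_section D k s ->
            mpoly.meval w (s e') = c * mpoly.meval z (s e)) ->
         glued e z e' w) &
      (forall (e : chart F) (z u : 'I_n -> K[i]) (c : K[i]),
         (forall s, is_section D k s ->
            \sum_(a < n) u a * mpoly.meval z (mpoly.mderiv a (s e)) =
            c * mpoly.meval z (s e)) ->
         forall a, u a = 0)].
Arguments very_ample K {n F} D k.

Definition ample (K : realType) n (F : fan n) (D : ray F -> int) : Prop :=
  exists2 k, (0 < k)%N & very_ample K D k.
Arguments ample K {n F} D.

Definition divisor_polytope (K : realType) n (F : fan n) (D : ray F -> int) :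
    set 'rV[K]_n :=
  [set m | forall r, - (D r)%:~R <= pairing m (toReal K (gen r))].
Arguments divisor_polytope K {n F} D.

Definition phi (K : realType) n (F : fan n) (D : ray F -> int) (e : chart F)
    (m : 'rV[K]_n) : 'rV[K]_n :=
  \row_(a < n) pairing (m - toReal K (vertex D e)) (toReal K (gen (e a))).

(* a bounded intersection of finitely many closed half-spaces *)
Definition polytope (K : realType) n (A : set 'rV[K]_n) : Prop :=
  bounded_set A /\
  exists H : seq ('rV[K]_n * K),
    A = [set m | forall h, h \in H -> h.2 <= pairing m h.1].

(* The order of the library on 'X_{1..n} is deglex; mlast is the smallest
   exponent having a nonzero coefficient. *)
Definition valuation (K : realType) n (F : fan n) (e : chart F)
    (s : chart F -> mpoly.mpoly n K[i]) : mpoly.multinom n :=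
  mpoly.mlast (s e).

Definition Vset (K : realType) n (F : fan n) (D : ray F -> int) (R : nat)
    (e : 'I_R -> chart F) (k : nat) (j : 'I_R) :
    set (chart F -> mpoly.mpoly n K[i]) :=
  [set s : chart F -> mpoly.mpoly n K[i] |
     [/\ is_section D k s,
         (exists c, s c != 0) &
         forall i, i != j -> (valuation (e j) s < valuation (e i) s)%O]].
Arguments Vset K {n F} D {R} e k j.

Definition exponent (K : realType) n (m : mpoly.multinom n) : 'rV[K]_n :=
  \row_(a < n) (m a)%:R.
Arguments exponent K {n} m.

Definition okounkov_body (K : realType) n (F : fan n) (D : ray F -> int)
    (R : nat) (e : 'I_R -> chart F) (j : 'I_R) : set 'rV[K]_n :=
  closure (\bigcup_(k in [set k : nat | (0 < k)%N])
    [set (k%:R : K)^-1 *: exponent K (valuation (e j) s) |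
       s in Vset K D e k j] : set 'rV[K]_n).
Arguments okounkov_body K {n F} D {R} e j.

(* Main.v *)
(* Independence of characters shows that the local expressions of a section of
   O(kD) are one and the same Laurent polynomial, whose support lies in kP;
   conversely every chi^m with m in kP is a section.  In the chart at the vertex
   x_e the sum of the exponents of chi^m is sum_a <m - k x_e, v_a>, which is k
   times height_e(m/k), and the deglex order compares these sums first.  Hence the
   subdivision is P_j = {m in P | height_j(m) <= height_i(m) for all i}: the
   valuations of V_{k,j} come from points of k P_j, and every lattice point of
   k P_j at which the inequalities are strict is attained by a monomial.
   Ampleness separates the vertices and makes P full-dimensional, so the strict
   inequalities have a common solution (near x_j), and rational strict points are
   dense in P_j. *)
Require Import Defs.
From mathcomp Require Import all_boot all_order all_algebra.
From mathcomp Require Import all_classical all_reals all_analysis.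
From mathcomp Require Import complex.
From mathcomp Require Import(canonicals, coercions) mpoly.
From mathcomp Require Import ring lra.

Set Implicit Arguments.
Unset Strict Implicit.
Unset Printing Implicit Defensive.

Import Order.TTheory GRing.Theory Num.Theory.
Import numFieldNormedType.Exports.

Local Open Scope classical_set_scope.
Local Open Scope ring_scope.

(** * Sections of O(kD) as Laurent polynomials *)

(** Independence of characters, by Artin's argument: the relation at [op g h] minus [f j h] times
    the relation at [g] no longer involves [f j], and induction applies. The subset [T] allows
    relations known only on the torus. *)
Lemma characters_free (L : idomainType) (G : Type) (op : G -> G -> G)
    (T : set G) (I : eqType) (f : I -> G -> L) (s : seq I) (c : I -> L) :
  (forall g h, T g -> T h -> T (op g h)) ->
  (forall i g h, T g -> T h -> f i (op g h) = f i g * f i h) ->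
  (forall i, exists2 g, T g & f i g != 0) ->
  (forall i j, i != j -> exists2 g, T g & f i g != f j g) ->
  uniq s -> (forall g, T g -> \sum_(i <- s) c i * f i g = 0) ->
  forall i, i \in s -> c i = 0.
Proof.
move=> Top fM f_neq0 f_neq; elim: s c => [//|j s IH] c /= /andP[js us] cf0.
have cs0 i : i \in s -> c i = 0.
  move=> si; have ij : i != j by apply: contraNneq js => <-.
  have [h Th fh] := f_neq _ _ ij.
  apply/eqP; rewrite -(mulIr_eq0 _ (mulIf (_ : f i h - f j h != 0))) ?subr_eq0//.
  apply/eqP; apply: (IH (fun i => c i * (f i h - f j h))) => // g Tg.
  have := cf0 _ (Top _ _ Tg Th); have := cf0 _ Tg.
  rewrite !big_cons fM// => /(canRL (addrK _)); rewrite sub0r => cj.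
  rewrite mulrA cj mulNr => /(canRL (addKr _)).
  rewrite opprK addr0 mulr_suml => sumE.
  apply/eqP; under eq_bigr do rewrite mulrBr mulrBl.
  rewrite sumrB subr_eq0; under [X in _ == X]eq_bigr do rewrite mulrAC.
  rewrite -sumE; apply/eqP/eq_big_seq => k sk.
  by rewrite fM// mulrA mulrAC.
move=> i; rewrite inE => /predU1P[->|/cs0//].
have [g Tg fg] := f_neq0 j.
have := cf0 _ Tg; rewrite big_cons big_seq big1; last first.
  by move=> k /cs0->; rewrite mul0r.
by rewrite addr0 => /eqP; rewrite mulf_eq0 (negbTE fg) orbF => /eqP.
Qed.

(** * Bilinearity of the pairing *)

Section Pairing.
Variables (A : comPzRingType) (n : nat).
Implicit Types (m v : 'rV[A]_n).

Lemma pairingE m v : pairing m v = (m *m v^T) 0 0.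
Proof. by rewrite mxE; apply: eq_bigr => i _; rewrite mxE. Qed.

Lemma pairingC m v : pairing m v = pairing v m.
Proof. by apply: eq_bigr => i _; rewrite mulrC. Qed.

Lemma pairingDl m m' v : pairing (m + m') v = pairing m v + pairing m' v.
Proof. by rewrite !pairingE mulmxDl mxE. Qed.

Lemma pairingBl m m' v : pairing (m - m') v = pairing m v - pairing m' v.
Proof. by rewrite !pairingE mulmxBl !mxE. Qed.

Lemma pairingNr m v : pairing m (- v) = - pairing m v.
Proof. by rewrite !pairingE linearN mulmxN mxE. Qed.

Lemma pairingMnl m v k : pairing (m *+ k) v = pairing m v *+ k.
Proof. by rewrite !pairingE -scaler_nat -scalemxAl mxE mulr_natl. Qed.

Lemma pairingZl c m v : pairing (c *: m) v = c * pairing m v.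
Proof. by rewrite !pairingE -scalemxAl mxE. Qed.

Lemma pairing_suml I (r : seq I) (P : pred I) (f : I -> 'rV[A]_n) v :
  pairing (\sum_(i <- r | P i) f i) v = \sum_(i <- r | P i) pairing (f i) v.
Proof.
rewrite pairingE mulmx_suml summxE.
by apply: eq_bigr => i _; rewrite pairingE.
Qed.

End Pairing.

Lemma pairing_toReal (K : realType) n (m v : 'rV[int]_n) :
  pairing (toReal K m) (toReal K v) = (pairing m v)%:~R.
Proof. by rewrite rmorph_sum; apply: eq_bigr => i _; rewrite !mxE rmorphM. Qed.

Section Charts.
Variables (n : nat) (F : fan n).
Hypothesis gens_unit : forall e : chart F, gens e \in unitmx.
Variables (K : realType) (D : ray F -> int).
Implicit Types (e : chart F) (m : 'rV[int]_n) (z : 'I_n -> K[i]).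
Local Notation mpol := (mpoly.mpoly n K[i]).

Lemma pairing_gens e m a : pairing m (gen (e a)) = (m *m (gens e)^T) 0 a.
Proof. by rewrite !mxE; apply: eq_bigr => i _; rewrite !mxE. Qed.

Lemma gens_inj e m m' :
  (forall a, pairing m (gen (e a)) = pairing m' (gen (e a))) -> m = m'.
Proof.
move=> mm'; apply: (can_inj (mulmxK (_ : (gens e)^T \in unitmx))).
  by rewrite unitmx_tr.
by apply/rowP => a; rewrite -!pairing_gens.
Qed.

Lemma pairing_dual_gen e a b :
  pairing (dual_gen e b) (gen (e a)) = (a == b)%:R.
Proof.
by rewrite pairing_gens -row_mul mulVmx ?unitmx_tr// !mxE eq_sym.
Qed.

Lemma pairing_vertex e a : pairing (vertex D e) (gen (e a)) = - D (e a).
Proof. by rewrite pairing_gens mulmxKV ?unitmx_tr// mxE. Qed.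

Lemma sum_dual_gen e m :
  \sum_(a < n) pairing m (gen (e a)) *: dual_gen e a = m.
Proof.
apply: (@gens_inj e) => a; rewrite pairing_suml (bigD1 a)//= pairingZl.
rewrite pairing_dual_gen eqxx mulr1 big1 ?addr0// => b ba.
by rewrite pairingZl pairing_dual_gen eq_sym (negbTE ba) mulr0.
Qed.

(* The exponent of the coordinate z_a in the local expression of the rational
   section chi^m of O(kD); it may be negative. *)
Definition vanishing_order k e m a : int := pairing m (gen (e a)) + D (e a) *+ k.

(** The absolute value only serves to land in the natural numbers; the monomial is the local
    expression of chi^m when all vanishing orders are nonnegative. *)
Definition local_monomial k e m : mpoly.multinom n :=
  mpoly.Multinom [tuple `|vanishing_order k e m a|%N | a < n].

(** The character that reads z^alpha in the chart [e]: z_a is the character of [dual_gen e a], and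
    the trivialisation by chi^(k x_e) accounts for the shift by [D (e a) *+ k]. *)
Definition global_exponent k e (alpha : mpoly.multinom n) : 'rV[int]_n :=
  \sum_(a < n) (Posz (alpha a) - D (e a) *+ k) *: dual_gen e a.

Lemma vanishing_order_global k e alpha a :
  vanishing_order k e (global_exponent k e alpha) a = alpha a.
Proof.
rewrite /vanishing_order pairing_suml (bigD1 a)//= pairingZl.
rewrite pairing_dual_gen eqxx mulr1 big1 ?addr0 ?subrK// => b ba.
by rewrite pairingZl pairing_dual_gen eq_sym (negbTE ba) mulr0.
Qed.

Lemma local_monomialE k e m a :
  0 <= vanishing_order k e m a ->
  Posz (local_monomial k e m a) = vanishing_order k e m a.
Proof. by move=> ?; rewrite mpoly.mnmE gez0_abs. Qed.

Lemma global_exponentK k e : cancel (global_exponent k e) (local_monomial k e).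
Proof.
by move=> alpha; apply/mpoly.mnmP => a; rewrite mpoly.mnmE vanishing_order_global.
Qed.

Lemma local_monomialK k e m : (forall a, 0 <= vanishing_order k e m a) ->
  global_exponent k e (local_monomial k e m) = m.
Proof.
move=> m0; apply: (@gens_inj e) => a.
have /eqP := vanishing_order_global k e (local_monomial k e m) a.
by rewrite local_monomialE// /vanishing_order (inj_eq (addIr _)) => /eqP.
Qed.

Lemma chi_unit e m z : (forall a, z a != 0) -> chi e m z != 0.
Proof. by move=> z0; apply/prodf_neq0 => a _; rewrite expfz_neq0. Qed.

Lemma chiD e m m' z : (forall a, z a != 0) ->
  chi e (m + m') z = chi e m z * chi e m' z.
Proof.
move=> z0; rewrite -big_split; apply: eq_bigr => a _.
by rewrite pairingDl expfzDr.
Qed.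

Lemma prodfXz (L : fieldType) I (r : seq I) (f : I -> L) (j : int) :
  (\prod_(i <- r) f i) ^ j = \prod_(i <- r) f i ^ j.
Proof.
by apply: (big_morph (fun x : L => x ^ j)) => [x y|]; rewrite ?expfzMl ?exp1rz.
Qed.

Lemma expfz_sum (L : fieldType) I (r : seq I) (x : L) (f : I -> int) : x != 0 ->
  x ^ (\sum_(i <- r) f i) = \prod_(i <- r) x ^ f i.
Proof. by move=> x0; apply: (big_morph (exprz x)) => // i j; rewrite expfzDr. Qed.

(** Expanding [m] in the dual basis of [e'] gives the identity, because integer powers add at
    nonzero coordinates. *)
Lemma chi_transition e e' m z : (forall a, z a != 0) ->
  chi e' m (fun b => chi e (dual_gen e' b) z) = chi e m z.
Proof.
move=> z0; rewrite /chi; under eq_bigr do rewrite prodfXz.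
rewrite exchange_big; apply: eq_bigr => a _ /=.
rewrite -{2}(sum_dual_gen e' m) pairing_suml expfz_sum//.
by apply: eq_bigr => b _; rewrite pairingZl mulrC exprz_exp.
Qed.

Lemma chi_free e (s : seq 'rV[int]_n) (c : 'rV[int]_n -> K[i]) : uniq s ->
  (forall z, (forall a, z a != 0) -> \sum_(m <- s) c m * chi e m z = 0) ->
  forall m, m \in s -> c m = 0.
Proof.
move=> us cs0; apply: (@characters_free _ ('I_n -> K[i]) (fun z w a => z a * w a)
  [set z | forall a, z a != 0] _ (chi e)) => //=.
- by move=> z w z0 w0 a; rewrite mulf_neq0.
- move=> m z w z0 w0; rewrite -big_split; apply: eq_bigr => a _.
  by rewrite expfzMl.
- by move=> m; exists (fun=> 1) => [a|]; rewrite ?chi_unit ?oner_neq0.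
- move=> m m' mm'.
  have [a ma] : exists a, pairing m (gen (e a)) != pairing m' (gen (e a)).
    apply/existsP; apply: contra_neqT mm' => /existsPn mm'.
    by apply: (@gens_inj e) => a; apply/eqP; have := mm' a; rewrite negbK.
  (* Two characters with different exponents at [a] differ at the point with coordinate 2 at [a] and
     1 elsewhere, as the integer powers of 2 are distinct. *)
  pose x : K[i] := real_complex K 2.
  have x0 : x != 0 by rewrite fmorph_eq0 pnatr_eq0.
  exists (fun b => if b == a then x else 1) => [b|].
    by case: ifP => _ //; exact: oner_neq0.
  have chix p : chi e p (fun b => if b == a then x else 1) = x ^ pairing p (gen (e a)).
    rewrite /chi (bigD1 a)//= eqxx big1 ?mulr1// => b /negbTE->.
    by rewrite exp1rz.
  rewrite !chix -!fmorphXz (inj_eq (fmorph_inj _)).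
  rewrite (inj_eq (ieexprIz _ _)) ?ltr0n//.
  by rewrite -subr_eq0 -(natrB _ (isT : (1 <= 2)%N)) pnatr_eq0.
Qed.

(** The coefficient of chi^m in the Laurent polynomial chi^(k x_e) times [s e]. The test is needed
    since [local_monomial] takes absolute values and would otherwise pick up a wrong monomial. *)
Definition coef k e (s : chart F -> mpol) m : K[i] :=
  if [forall a, 0 <= vanishing_order k e m a]
  then mpoly.mcoeff (local_monomial k e m) (s e)
  else 0.

Lemma coef_global k e (s : chart F -> mpol) alpha :
  coef k e s (global_exponent k e alpha) = mpoly.mcoeff alpha (s e).
Proof.
rewrite /coef global_exponentK ifT//; apply/forallP => a.
by rewrite vanishing_order_global.
Qed.

Lemma coef_neq0 k e (s : chart F -> mpol) m : coef k e s m != 0 ->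
  (forall a, 0 <= vanishing_order k e m a) /\
  local_monomial k e m \in mpoly.msupp (s e).
Proof.
rewrite /coef; case: ifP => [/forallP m0|_]; last by rewrite eqxx.
by rewrite -mpoly.mcoeff_msupp.
Qed.

(** Allowing [U] to exceed the support makes it possible to expand a section over the same list in
    two charts. *)
Lemma meval_section k e (s : chart F -> mpol) (U : seq 'rV[int]_n) z : uniq U ->
  {subset map (global_exponent k e) (mpoly.msupp (s e)) <= U} ->
  (forall a, z a != 0) ->
  chi e (vertex D e *+ k) z * mpoly.meval z (s e) =
  \sum_(m <- U) coef k e s m * chi e m z.
Proof.
move=> uU sU z0; set V := map _ _ in sU.
rewrite (bigID (mem V))/= [X in _ + X]big1 ?addr0; last first.
  move=> m; apply: contraNeq; rewrite mulf_eq0 negb_or => /andP[/coef_neq0[m0 sm] _].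
  by apply/mapP; exists (local_monomial k e m); rewrite ?local_monomialK.
have uV : uniq V.
  by rewrite (map_inj_uniq (can_inj (global_exponentK k e))) mpoly.msupp_uniq.
have VU : perm_eq V [seq m <- U | m \in V].
  apply: uniq_perm => // [|m]; first exact: filter_uniq.
  by rewrite mem_filter; case: (boolP (m \in V)) => // /sU ->.
rewrite -big_filter -(perm_big _ VU) big_map mpoly.mevalE mulr_sumr.
apply: eq_bigr => alpha _; rewrite coef_global mulrCA; congr (_ * _).
rewrite -big_split; apply: eq_bigr => a _ /=.
rewrite exprnP -expfzDr// pairingMnl pairing_vertex.
have := vanishing_order_global k e alpha a; rewrite /vanishing_order => <-.
by rewrite mulNrn addrCA addNr addr0.
Qed.

(** On the torus the gluing rule equates the two Laurent polynomials as functions, so [chi_free]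
    equates their coefficients. *)
Lemma coef_chart k (s : chart F -> mpol) e e' m :
  is_section D k s -> coef k e s m = coef k e' s m.
Proof.
move=> sD.
pose U := undup (map (global_exponent k e) (mpoly.msupp (s e)) ++
                 map (global_exponent k e') (mpoly.msupp (s e'))).
have [mU|mU] := boolP (m \in U); last first.
  move: mU; rewrite mem_undup mem_cat negb_or => /andP[me me'].
  transitivity (0 : K[i]); [|symmetry].
    apply: contraNeq me => /coef_neq0[m0 sm].
    by apply/mapP; exists (local_monomial k e m); rewrite ?local_monomialK.
  apply: contraNeq me' => /coef_neq0[m0 sm].
  by apply/mapP; exists (local_monomial k e' m); rewrite ?local_monomialK.
apply/eqP; rewrite -subr_eq0; apply/eqP.
apply: (@chi_free e U (fun m => coef k e s m - coef k e' s m)) => //.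
  exact: undup_uniq.
move=> z z0; under eq_bigr do rewrite mulrBl.
(* The coordinates in [e'] of the torus point [z]; both sums become values of the same section at
   this point. *)
pose w b := chi e (dual_gen e' b) z.
have w0 a : w a != 0 by exact: chi_unit.
rewrite sumrB -meval_section ?undup_uniq//; last first.
  by move=> p; rewrite mem_undup mem_cat => ->.
under eq_bigr do rewrite -(chi_transition e e')//.
rewrite -meval_section ?undup_uniq//; last first.
  by move=> p; rewrite mem_undup mem_cat => ->; rewrite orbT.
rewrite (sD e e' z w); last by split.
by rewrite chi_transition// mulrA -chiD// mulrnBl subrKC subrr.
Qed.

Definition monomial_section k m : chart F -> mpol :=
  fun e => mpoly.mpolyX K[i] (local_monomial k e m).

(** Nonnegative orders remove the absolute values, and the gluing rule is checked one coordinate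
    [z a] at a time; a vanishing coordinate needs its own case because exponents add only at nonzero
    numbers. *)
Lemma monomial_sectionP k m :
  (forall r, 0 <= pairing m (gen r) + D r *+ k) ->
  is_section D k (monomial_section k m).
Proof.
move=> m0 e e' z w [ze wE]; rewrite !mpoly.mevalX.
under eq_bigr do rewrite wE exprnP local_monomialE ?m0// /chi prodfXz.
rewrite exchange_big -big_split; apply: eq_bigr => a _ /=.
rewrite exprnP local_monomialE ?m0//.
have [z0|z0] := eqVneq (z a) 0.
  (* The ray e a then belongs to both cones, so that the two expressions have the
     same exponent at z_a, and the transition function does not involve z_a. *)
  have : e a \in chart_cone e' by apply: contraTT isT => /ze; rewrite z0 eqxx.
  move=> /imsetP[b _ eab]; rewrite (bigD1 b)//= big1 => [|c cb].
    rewrite mulr1 pairingMnl pairingBl pairing_vertex eab pairing_vertex.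
    rewrite pairing_dual_gen eqxx expr1z opprK addNr mul0rn expr0z mul1r.
    by rewrite /vanishing_order -eab.
  by rewrite eab pairing_dual_gen eq_sym (negbTE cb) expr0z exp1rz.
under eq_bigr do rewrite exprz_exp.
rewrite -expfz_sum// -expfzDr//; congr (_ ^ _).
(* The vanishing orders in [e'] are the coordinates of m - k x_e' in the dual basis of [e']. *)
transitivity (pairing (m - vertex D e' *+ k) (gen (e a))).
  rewrite -(sum_dual_gen e' (m - _)) pairing_suml.
  apply: eq_bigr => b _; rewrite pairingZl mulrC; congr (_ * _).
  by rewrite pairingBl pairingMnl pairing_vertex /vanishing_order mulNrn opprK.
rewrite !(pairingBl, pairingMnl) pairing_vertex /vanishing_order.
by ring.
Qed.

Lemma valuation_monomial k m e :
  valuation e (monomial_section k m) = local_monomial k e m.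
Proof.
apply: mpoly.mlastE; first by rewrite mpoly.msuppX inE.
by move=> m'; rewrite mpoly.msuppX inE => /eqP->.
Qed.

Lemma exists_chart S : S \in maxcones F -> #|S| = n ->
  exists e : chart F, chart_cone e = S.
Proof.
move=> SF Sn; pose f := [ffun a : 'I_n => enum_val (cast_ord (esym Sn) a)].
have fS : [set f a | a : 'I_n]%SET = S.
  apply/setP => r; apply/imsetP/idP => [[a _ ->]|Sr].
    by rewrite ffunE enum_valP.
  exists (cast_ord Sn (enum_rank_in Sr r)) => //.
  by rewrite ffunE cast_ordK enum_rankK_in.
have f_chart : is_chart f.
  rewrite /is_chart fS SF andbT; apply/injectiveP => a b.
  by rewrite !ffunE => /enum_val_inj/cast_ord_inj.
by exists (Chart f_chart).
Qed.

(** Each ray occurs in the cone of some chart; read in that chart, a nonzero coefficient forces a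
    nonnegative order along the ray. Hence the support of a section lies in kP. *)
Lemma is_section_order k (s : chart F -> mpol) e m r : is_section D k s ->
  (forall r, exists2 S, S \in maxcones F & r \in S) ->
  (forall S, S \in maxcones F -> #|S| = n) ->
  coef k e s m != 0 -> 0 <= pairing m (gen r) + D r *+ k.
Proof.
move=> sD raysF conesF sm; have [S SF Sr] := raysF r.
have [e' e'S] := exists_chart SF (conesF _ SF).
move: Sr; rewrite -e'S => /imsetP[a _ ->].
by move: sm; rewrite (coef_chart e e') // => /coef_neq0[/(_ a)].
Qed.

Lemma valuation_coef k (s : chart F -> mpol) e : is_section D k s ->
  s e != 0 -> coef k e s (global_exponent k e (valuation e s)) != 0.
Proof.
by move=> sD se0; rewrite coef_global -mpoly.mcoeff_msupp mpoly.mlast_supp.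
Qed.

Lemma section_neq0 k (s : chart F -> mpol) e e' : is_section D k s ->
  s e != 0 -> s e' != 0.
Proof.
move=> sD se0; have := valuation_coef sD se0; rewrite (coef_chart e e')//.
by move=> /coef_neq0[_]; apply: contraTneq => ->; rewrite mpoly.msupp0.
Qed.

End Charts.

(** * Approximation of polyhedra by lattice points *)

Section Polyhedra.
Variables (K : realType) (n : nat).
Implicit Types (x y : 'rV[K]_n) (H : seq ('rV[K]_n * K)) (eps : K).

Definition coord_close x y eps : Prop := forall i, `|x 0 i - y 0 i| < eps.

Lemma nbhs_close x (U : set 'rV[K]_n) :
  nbhs x U -> exists2 eps, 0 < eps & forall y, coord_close x y eps -> U y.
Proof.
move=> /nbhs_ballP[eps eps0 xU]; exists eps => // y xy; apply: xU.
by split=> // i j; rewrite ord1; exact: xy.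
Qed.

Lemma close_nbhs x eps : 0 < eps -> nbhs x [set y | coord_close x y eps].
Proof.
move=> eps0; apply/nbhs_ballP; exists eps => // y [_ xy] i; exact: xy.
Qed.

Lemma ler_pairing x y (h : 'rV[K]_n) eps : coord_close x y eps ->
  `|pairing x h - pairing y h| <= eps * \sum_i `|h 0 i|.
Proof.
move=> xy; rewrite -pairingBl mulr_sumr.
apply: (le_trans (ler_norm_sum _ _ _)); apply: ler_sum => i _.
by rewrite normrM ler_wpM2r// !mxE ltW.
Qed.

(** The summand 1 keeps the denominator positive when all [f i] vanish, and makes the bound
    strict. *)
Lemma mul_sum_norm_lt I (r : seq I) (f : I -> K) eps : 0 < eps ->
  eps / (1 + \sum_(i <- r) `|f i|) * \sum_(i <- r) `|f i| < eps.
Proof.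
move=> eps0; have f0 : 0 <= \sum_(i <- r) `|f i| by apply: sumr_ge0.
rewrite mulrAC ltr_pdivrMr ?ltr_pM2l//; lra.
Qed.

Lemma div_sum_norm_gt0 I (r : seq I) (f : I -> K) eps : 0 < eps ->
  0 < eps / (1 + \sum_(i <- r) `|f i|).
Proof.
by move=> eps0; rewrite divr_gt0// ltr_pwDl// sumr_ge0.
Qed.

Lemma strict_close H x : (forall h, h \in H -> h.2 < pairing x h.1) ->
  exists2 eps, 0 < eps &
    forall y, coord_close x y eps -> forall h, h \in H -> h.2 < pairing y h.1.
Proof.
elim: H => [|h H IH] xH; first by exists 1.
have [|eps eps0 epsH] := IH.
  by move=> g gH; apply: xH; rewrite inE gH orbT.
have hx : 0 < pairing x h.1 - h.2 by rewrite subr_gt0 xH ?mem_head.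
(* At distance less than [d] the pairing with [h.1] changes by less than its slack at [x]. *)
pose d := (pairing x h.1 - h.2) / (1 + \sum_i `|h.1 0 i|).
exists (Num.min eps d) => [|y xy g]; first by rewrite lt_min eps0 div_sum_norm_gt0.
rewrite inE => /predU1P[->|]; last first.
  by apply: epsH => i; apply: lt_le_trans (xy i) _; rewrite ge_min lexx.
have xyd : coord_close x y d.
  by move=> i; apply: lt_le_trans (xy i) _; rewrite ge_min lexx orbT.
have := le_lt_trans (ler_pairing h.1 xyd) (mul_sum_norm_lt _ _ hx).
by rewrite ltr_norml => /andP[]; lra.
Qed.

Definition polyhedron H : set 'rV[K]_n :=
  [set x | forall h, h \in H -> h.2 <= pairing x h.1].

Lemma closed_polyhedron H : closed (polyhedron H).
Proof.
move=> x xH h hH; rewrite leNgt; apply/negP => hx.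
(* A violated inequality is a strict one with reversed signs, so it stays violated near [x]. *)
have [|eps eps0 xeps] := @strict_close [:: (- h.1, - h.2)] x.
  move=> g; rewrite inE => /eqP->/=.
  by rewrite pairingNr ltrN2.
have [y [yH xy]] := xH _ (close_nbhs x eps0).
have := xeps y xy _ (mem_head _ _) => /=.
rewrite pairingNr ltrN2.
by rewrite ltNge yH.
Qed.

(** Along the segment each inequality is affine: one strict at [x] survives a short move, and one
    weak at [x] but strict at [y] becomes strict immediately. *)
Lemma strict_segment H x y :
  (forall h, h \in H -> h.2 < pairing x h.1 \/
                        h.2 <= pairing x h.1 /\ h.2 < pairing y h.1) ->
  exists2 T, 0 < T & forall t, 0 < t < T ->
    forall h, h \in H -> h.2 < pairing (x + t *: (y - x)) h.1.
Proof.
elim: H => [|h H IH] xyH; first by exists 1.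
have [|T T0 TH] := IH.
  by move=> g gH; apply: xyH; rewrite inE gH orbT.
suff [T' T'0 T'h] : exists2 T', 0 < T' & forall t, 0 < t < T' ->
    h.2 < pairing (x + t *: (y - x)) h.1.
  exists (Num.min T T') => [|t]; first by rewrite lt_min T0.
  rewrite lt_min => /and3P[t0 tT tT'] g; rewrite inE => /predU1P[->|].
    by apply: T'h; rewrite t0.
  by apply: TH; rewrite t0.
have xyE t : pairing (x + t *: (y - x)) h.1 =
    pairing x h.1 + t * (pairing y h.1 - pairing x h.1).
  by rewrite pairingDl pairingZl pairingBl.
have [hx|[hx hy]] := xyH h (mem_head _ _); last first.
  exists 1 => // t /andP[t0 t1]; rewrite xyE; nra.
pose c := `|pairing y h.1 - pairing x h.1|.
have c0 : 0 <= c by exact: normr_ge0.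
exists ((pairing x h.1 - h.2) / (1 + c)) => [|t /andP[t0]].
  by rewrite divr_gt0 ?subr_gt0//; lra.
rewrite ltr_pdivlMr; last lra.
move=> tc; rewrite xyE.
have : - (t * c) <= t * (pairing y h.1 - pairing x h.1).
  by rewrite -mulrN ler_pM2l// lerNl ler_normr lexx orbT.
lra.
Qed.

Lemma segment_close x y eps : 0 < eps ->
  exists2 T, 0 < T & forall t, 0 < t < T -> coord_close x (x + t *: (y - x)) eps.
Proof.
move=> eps0; exists (eps / (1 + \sum_i `|(y - x) 0 i|)).
  exact: div_sum_norm_gt0.
move=> t /andP[t0 tT] i.
apply: le_lt_trans (mul_sum_norm_lt (index_enum 'I_n) ((y - x) 0) eps0).
rewrite [in X in `|X|]mxE opprD addNKr normrN [in X in `|X|]mxE normrM.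
apply: ler_pM => //; first by rewrite gtr0_norm// ltW.
by rewrite (bigD1 i)//= lerDl sumr_ge0.
Qed.

Lemma lattice_close x eps : 0 < eps -> exists (N : nat) (m : 'rV[int]_n),
  (0 < N)%N /\ coord_close x (N%:R^-1 *: toReal K m) eps.
Proof.
(* With N > 1/eps, rounding N x down moves [x] by less than 1/N, hence by less than [eps]. *)
move=> eps0; pose N := (Num.trunc eps^-1).+1.
have N0 : 0 < N%:R :> K by rewrite ltr0n.
exists N, (\row_i Num.floor (N%:R * x 0 i)); split=> // i; rewrite !mxE.
have /andP[] := floor_itv (N%:R * x 0 i); rewrite intrD.
set f := _%:~R => fx xf.
rewrite -(ltr_pM2l N0) -{1}(gtr0_norm N0) -normrM mulrBr mulVKf ?gt_eqF//.
have : 1 < N%:R * eps by rewrite -ltr_pdivrMr// div1r truncnS_gt.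
by rewrite ltr_norml; lra.
Qed.

(** A short move from [x] towards the strict point [y] reaches a strict point, which has a whole
    neighbourhood of strict points and so a rational one. *)
Lemma lattice_dense H x y eps : polyhedron H x ->
  (forall h, h \in H -> h.2 < pairing y h.1) -> 0 < eps ->
  exists (N : nat) (m : 'rV[int]_n),
    [/\ (0 < N)%N, coord_close x (N%:R^-1 *: toReal K m) eps &
        forall h, h \in H -> h.2 < pairing (N%:R^-1 *: toReal K m) h.1].
Proof.
(* One half of [eps] is for the move towards [y], the other for the rational approximation. *)
move=> xH yH eps0; have eps20 : 0 < eps / 2 by rewrite divr_gt0.
have [T T0 xyH] : exists2 T, 0 < T & forall t, 0 < t < T ->
    forall h, h \in H -> h.2 < pairing (x + t *: (y - x)) h.1.
  by apply: strict_segment => h hH; right; split; [exact: xH|exact: yH].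
have [T' T'0 xyc] := segment_close x y eps20.
pose t := Num.min T T' / 2.
have m0 : 0 < Num.min T T' by rewrite lt_min T0.
have tT : t < T.
  have : Num.min T T' <= T by rewrite ge_min lexx.
  by rewrite /t; lra.
have tT' : t < T'.
  have : Num.min T T' <= T' by rewrite ge_min lexx orbT.
  by rewrite /t; lra.
have t0 : 0 < t by rewrite divr_gt0.
have [|d d0 dH] := @strict_close H (x + t *: (y - x)).
  by apply: xyH; rewrite t0.
have md0 : 0 < Num.min d (eps / 2) by rewrite lt_min d0.
have [N [m [N0 ym]]] := lattice_close (x + t *: (y - x)) md0.
exists N, m; split=> // [i|]; last first.
  by apply: dH => i; apply: lt_le_trans (ym i) _; rewrite ge_min lexx.
have := xyc t; rewrite t0 => /(_ tT' i) ?.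
have : `|(x + t *: (y - x)) 0 i - (N%:R^-1 *: toReal K m) 0 i| < eps / 2.
  by apply: lt_le_trans (ym i) _; rewrite ge_min lexx orbT.
rewrite (_ : x 0 i - _ = (x 0 i - (x + t *: (y - x)) 0 i) +
  ((x + t *: (y - x)) 0 i - (N%:R^-1 *: toReal K m) 0 i)); last by ring.
by move=> ?; rewrite (le_lt_trans (ler_normD _ _))//; lra.
Qed.

End Polyhedra.

(** * The polytope of an ample divisor *)

Lemma mpoly_meval0 (L : idomainType) n (p : mpoly.mpoly n L) :
  mpoly.meval (fun=> 0) p = mpoly.mcoeff mpoly.mnm0 p.
Proof.
have prod0 (m : mpoly.multinom n) :
    \prod_(i < n) (0 : L) ^+ m i = (m == mpoly.mnm0)%:R.
  have [->|] := eqVneq m; first by rewrite big1// => i _; rewrite mpoly.mnm0E.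
  rewrite -mpoly.mdeg_eq0 mpoly.mdegE sum_nat_eq0 negb_forall => /existsP[i mi].
  by apply/eqP/prodf_eq0; exists i; rewrite // expf_eq0 eqxx andbT lt0n.
rewrite mpoly.mevalE; under eq_bigr do rewrite prod0.
have [p0|p0] := boolP (mpoly.mnm0 \in mpoly.msupp p); last first.
  rewrite mpoly.memN_msupp_eq0// big_seq big1// => m mp.
  by case: eqVneq mp => [->|]; rewrite ?mulr0// (negbTE p0).
rewrite (bigD1_seq _ p0) ?mpoly.msupp_uniq//= eqxx mulr1 big1 ?addr0// => m.
by move=> /negbTE->; rewrite mulr0.
Qed.

Lemma toReal_inj (K : realType) n : injective (@toReal K n).
Proof.
move=> m m' /rowP mm'; apply/rowP => i; have := mm' i.
by rewrite !mxE => /intr_inj.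
Qed.

Section Toric.
Variables (K : realType) (n : nat) (F : fan n) (D : ray F -> int).
Hypothesis hF : smooth_complete_fan K F.
Implicit Types (e : chart F) (m x : 'rV[K]_n).

Let gens_unit e : gens e \in unitmx. Proof. by case: hF. Qed.

Lemma exists_chart_ray r : exists (e : chart F) a, r = e a.
Proof.
have [conesF _ raysF _ _] := hF; have [S SF Sr] := raysF r.
have [e eS] := exists_chart SF (conesF _ SF).
by move: Sr; rewrite -eS => /imsetP[a _ ->]; exists e, a.
Qed.

Lemma sum_dual_genR e m :
  \sum_(a < n) pairing m (toReal K (gen (e a))) *: toReal K (dual_gen e a) = m.
Proof.
transitivity (m *m map_mx intr (gens e)^T *m map_mx intr (invmx (gens e)^T)).
  rewrite [RHS]mulmx_sum_row; apply: eq_bigr => a _; congr (_ *: _).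
    by rewrite mxE; apply: eq_bigr => i _; rewrite !mxE.
  by apply/rowP => i; rewrite !mxE.
by rewrite -mulmxA -map_mxM mulmxV ?unitmx_tr// map_mx1 mulmx1.
Qed.

Lemma pairing_dual_genR e a b :
  pairing (toReal K (dual_gen e b)) (toReal K (gen (e a))) = (a == b)%:R.
Proof. by rewrite pairing_toReal pairing_dual_gen// mulrz_nat. Qed.

Lemma phiE e m a : phi D e m 0 a = pairing m (toReal K (gen (e a))) + (D (e a))%:~R.
Proof.
by rewrite mxE pairingBl pairing_toReal pairing_vertex// rmorphN opprK.
Qed.

Definition phi_inv e (y : 'rV[K]_n) : 'rV[K]_n :=
  toReal K (vertex D e) + \sum_(a < n) y 0 a *: toReal K (dual_gen e a).

Lemma phiK e : cancel (phi D e) (phi_inv e).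
Proof.
move=> m; rewrite /phi_inv; under eq_bigr do rewrite mxE.
by rewrite sum_dual_genR addrC subrK.
Qed.

Lemma phi_invK e : cancel (phi_inv e) (phi D e).
Proof.
move=> y; apply/rowP => a; rewrite mxE /phi_inv addrAC subrr add0r pairing_suml.
rewrite (bigD1 a)//= pairingZl pairing_dual_genR eqxx mulr1 big1 ?addr0// => b ba.
by rewrite pairingZl pairing_dual_genR eq_sym (negbTE ba) mulr0.
Qed.

Lemma pairing_lattice k (m : 'rV[int]_n) r : (0 < k)%N ->
  pairing (k%:R^-1 *: toReal K m) (toReal K (gen r)) + (D r)%:~R =
  k%:R^-1 * (pairing m (gen r) + D r *+ k)%:~R.
Proof.
move=> k0; rewrite pairingZl pairing_toReal rmorphD/= mulrDr; congr (_ + _).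
by rewrite rmorphMn -[_%:~R *+ k]mulr_natl mulKf// pnatr_eq0 -lt0n.
Qed.

Lemma phi_lattice k e (m : 'rV[int]_n) : (0 < k)%N ->
  phi D e (k%:R^-1 *: toReal K m) = k%:R^-1 *: \row_a (vanishing_order D k e m a)%:~R.
Proof.
by move=> k0; apply/rowP => a; rewrite phiE pairing_lattice// !mxE.
Qed.

(** * Heights over the vertices *)

Definition height e m : K := \sum_(a < n) phi D e m 0 a.

Lemma heightE e m : height e m =
  pairing m (\sum_(a < n) toReal K (gen (e a))) + \sum_(a < n) (D (e a))%:~R.
Proof.
rewrite pairingC pairing_suml -big_split; apply: eq_bigr => a _.
by rewrite phiE pairingC.
Qed.

Lemma height_lattice k e (m : 'rV[int]_n) : (0 < k)%N ->
  height e (k%:R^-1 *: toReal K m) =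
  k%:R^-1 * (\sum_(a < n) vanishing_order D k e m a)%:~R.
Proof.
move=> k0; rewrite rmorph_sum mulr_sumr; apply: eq_bigr => a _.
by rewrite phi_lattice// !mxE.
Qed.

Lemma height_vertex e : height e (toReal K (vertex D e)) = 0.
Proof.
apply: big1 => a _; rewrite phiE pairing_toReal pairing_vertex//.
by rewrite rmorphN addNr.
Qed.

(** The coordinates of [phi D e'] are nonnegative on P; if their sum vanished at x_e, all would
    vanish, and the point would be x_e'. *)
Lemma vertex_gt0 e e' : vertex D e != vertex D e' ->
  divisor_polytope K D (toReal K (vertex D e)) ->
  0 < height e' (toReal K (vertex D e)).
Proof.
move=> ee' eP.
have phi0 a : 0 <= phi D e' (toReal K (vertex D e)) 0 a.
  by rewrite phiE -lerBlDr sub0r.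
rewrite lt_def sumr_ge0// andbT psumr_eq0//; apply: contra_neqN ee' => /allP z.
apply: (@toReal_inj K); rewrite -(phiK e' (toReal K (vertex D e))).
rewrite /phi_inv big1 ?addr0// => a _.
by have /eqP-> := z a (mem_index_enum a); rewrite scale0r.
Qed.

Lemma global_exponentE k e alpha : global_exponent D k e alpha =
  vertex D e *+ k + \sum_(a < n) Posz (alpha a) *: dual_gen e a.
Proof.
apply: (gens_inj gens_unit (e := e)) => a.
have /(canRL (addrK _)) -> := vanishing_order_global gens_unit D k e alpha a.
rewrite pairingDl pairingMnl pairing_vertex// pairing_suml (bigD1 a)//=.
rewrite pairingZl pairing_dual_gen// eqxx mulr1 big1 => [|b ba].
  by rewrite addr0 mulNrn addrC.
by rewrite pairingZl pairing_dual_gen// eq_sym (negbTE ba) mulr0.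
Qed.

(** * Sections of a very ample multiple at the fixed points *)

Lemma section_order k (s : chart F -> mpoly.mpoly n K[i]) e alpha r :
  is_section D k s -> mpoly.mcoeff alpha (s e) != 0 ->
  0 <= pairing (global_exponent D k e alpha) (gen r) + D r *+ k.
Proof.
have [conesF _ raysF _ _] := hF.
move=> sD salpha; apply: (is_section_order gens_unit (e := e) r sD) => //.
by rewrite coef_global.
Qed.

Lemma global_exponent0 k e : global_exponent D k e mpoly.mnm0 = vertex D e *+ k.
Proof.
rewrite global_exponentE big1 ?addr0// => a _.
by rewrite mpoly.mnm0E scale0r.
Qed.

(** A section not vanishing at the origin of the chart has a nonzero constant term, so k x_e is in
    its support and therefore in kP. *)
Lemma very_ample_vertex k e r : very_ample K D k ->
  0 <= pairing (vertex D e *+ k) (gen r) + D r *+ k.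
Proof.
case=> /(_ e (fun=> 0))[s sD]; rewrite mpoly_meval0 => s0 _ _.
by rewrite -global_exponent0; exact: section_order sD s0.
Qed.

(** Being an immersion at the origin requires a section with a nonzero linear term z_a; the
    corresponding exponent k x_e + [dual_gen e a] then lies in kP. *)
Lemma very_ample_edge k e a r : very_ample K D k ->
  0 <= pairing (vertex D e *+ k + dual_gen e a) (gen r) + D r *+ k.
Proof.
case=> _ _ immersion.
have [s sD sa] : exists2 s : chart F -> mpoly.mpoly n K[i],
    is_section D k s & mpoly.mcoeff (mpoly.mnm1 a) (s e) != 0.
  (* Without such a section the a-th tangent vector [u] would be killed, with [c] = 0. *)
  apply: contrapT => nos; pose u b : K[i] := (b == a)%:R.
  suff /immersion/(_ a)/eqP : forall s, is_section D k s ->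
      \sum_(b < n) u b * mpoly.meval (fun=> 0) (mpoly.mderiv b (s e)) =
      0 * mpoly.meval (fun=> 0) (s e) by rewrite /u eqxx oner_eq0.
  move=> s sD; rewrite mul0r big1// => b _.
  have [->|ba] := eqVneq b a; last by rewrite /u (negbTE ba) mul0r.
  rewrite mpoly_meval0 mpoly.mcoeff_mderiv mpoly.add0m.
  have [->|s0] := eqVneq (mpoly.mcoeff (mpoly.mnm1 a) (s e)) 0.
    by rewrite mul0rn mulr0.
  by exfalso; apply: nos; exists s.
have := section_order r sD sa; rewrite global_exponentE (bigD1 a)//=.
rewrite mpoly.mnm1E eqxx scale1r big1 ?addr0// => b ba.
by rewrite mpoly.mnm1E eq_sym (negbTE ba) scale0r.
Qed.

(** If x_e = x_e', every section has the same value at both origins, namely its coefficient at k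
    x_e. Separation of points then glues the origins, and since all coordinates vanish there, no ray
    of [e] is outside the cone of [e']. *)
Lemma very_ample_vertex_inj k e e' : very_ample K D k ->
  vertex D e = vertex D e' -> chart_cone e \subset chart_cone e'.
Proof.
case=> _ separation _ ee'; pose O : 'I_n -> K[i] := fun=> 0.
have [] := separation e e' O O 1 (oner_neq0 _).
  move=> s sD; rewrite mul1r !mpoly_meval0 -!(coef_global gens_unit D k).
  by rewrite !global_exponent0 ee' (coef_chart gens_unit e e' _ sD).
move=> ee'_cone _; apply/fintype.subsetP => _ /imsetP[a _ ->].
by apply: contraTT isT => /ee'_cone; rewrite eqxx.
Qed.

Lemma vertex_in_polytope k e : (0 < k)%N -> very_ample K D k ->
  divisor_polytope K D (toReal K (vertex D e)).
Proof.
move=> k0 kD r; rewrite -subr_ge0 opprK pairing_toReal -rmorphD/=.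
have := very_ample_vertex e r kD; rewrite pairingMnl -mulrnDl pmulrn_lge0//.
by rewrite ler0z.
Qed.

Lemma interior_polytope k e : (0 < k)%N -> very_ample K D k ->
  exists x, forall r, - (D r)%:~R < pairing x (toReal K (gen r)).
Proof.
move=> k0 kD; pose N := (k * n.+1)%N; have N0 : (0 < N)%N by rewrite muln_gt0 k0.
(* N^-1 c is the barycenter of x_e and the points x_e + k^-1 dual_gen e a. *)
pose c := vertex D e *+ N + \sum_(a < n) dual_gen e a.
exists (N%:R^-1 *: toReal K c) => r.
rewrite -subr_gt0 opprK pairing_lattice// mulr_gt0 ?invr_gt0 ?ltr0n// ltr0z.
have -> : pairing c (gen r) + D r *+ N =
    (pairing (vertex D e *+ k) (gen r) + D r *+ k) +
    \sum_(a < n) (pairing (vertex D e *+ k + dual_gen e a) (gen r) + D r *+ k).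
  under eq_bigr do rewrite pairingDl addrAC.
  rewrite big_split/= sumr_const card_ord addrA -mulrS /c pairingDl pairing_suml.
  by rewrite !pairingMnl -mulrnDl -mulrnA addrAC -mulrnDl.
have vge0 := very_ample_vertex e r kD.
have ege0 a := very_ample_edge e a r kD.
rewrite lt_def addr_ge0 ?sumr_ge0// andbT paddr_eq0 ?sumr_ge0// psumr_eq0//.
(* Equality at the barycenter forces equality at all n+1 points, so [gen r] pairs to zero with the
   dual basis of [e] and hence with all of M; but it pairs to 1 with a dual vector of a chart
   containing [r]. *)
apply/negP => /andP[/eqP v0 /allP e0].
have [e' [b rE]] := exists_chart_ray r.
have := pairing_dual_gen gens_unit e' b b.
rewrite eqxx -rE -(sum_dual_gen gens_unit e (dual_gen e' b)) pairing_suml big1//.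
move=> a _; have /eqP := e0 a (mem_index_enum a).
by rewrite pairingDl addrAC v0 add0r pairingZl => ->; rewrite mulr0.
Qed.

(** By completeness of the fan every vector is a nonnegative combination of ray generators, so its
    pairing is bounded below on P; applied to plus and minus the standard basis, this bounds the
    coordinates. *)
Lemma bounded_polytope : bounded_set (divisor_polytope K D).
Proof.
have /choice[c cP] (v : 'rV[K]_n) : exists c,
    forall m, divisor_polytope K D m -> - c <= pairing m v.
  have [_ _ _ _ complete] := hF; have [S _ [c [c0 ->]]] := complete v.
  exists (\sum_(r in S) c r * (D r)%:~R) => m mP.
  rewrite pairingC pairing_suml -sumrN; apply: ler_sum => r _.
  by rewrite pairingZl -mulrN ler_wpM2l// pairingC; exact: mP.
pose d i : 'rV[K]_n := delta_mx 0 i.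
exists (\sum_i (`|c (d i)| + `|c (- d i)|)); split; first exact: num_real.
move=> M /ltW BM m mP /=.
have B0 i : 0 <= `|c (d i)| + `|c (- d i)| by rewrite addr_ge0.
have mi (i : 'I_n) : pairing m (d i) = m 0 i.
  rewrite /pairing (bigD1 i)//= mxE !eqxx mulr1 big1 ?addr0// => l li.
  by rewrite mxE (negbTE li) andbF mulr0.
apply: le_trans BM; rewrite [leLHS]/Num.Def.normr/= mx_normrE.
apply: bigmax_le => [|[i0 i] _]; first exact: sumr_ge0.
rewrite ord1/= (bigD1 i)//= -[leLHS]addr0 lerD// ?sumr_ge0//.
have := cP (d i) _ mP; have := cP (- d i) _ mP; rewrite pairingNr mi.
have := ler_norm (c (d i)); have := ler_norm (c (- d i)).
have := normr_ge0 (c (d i)); have := normr_ge0 (c (- d i)).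
by rewrite ler_norml; lra.
Qed.

(** * The subdivision *)

Section Cells.
Variables (R : nat) (e : 'I_R -> chart F).

(** The height at [i] is affine with linear part [w i] and constant [d i], so the second list
    compares the height at [j] with the others. The index [j] itself is left out, since its trivial
    inequality has no strict solution. *)
Definition cell_ineqs (j : 'I_R) : seq ('rV[K]_n * K) :=
  let w i := \sum_(a < n) toReal K (gen (e i a)) in
  let d i := \sum_(a < n) (D (e i a))%:~R in
  [seq (toReal K (gen r), - (D r)%:~R) | r <- enum (ray F)] ++
  [seq (w i - w j, d j - d i) | i <- enum 'I_R & i != j].

Definition cell j := polyhedron (cell_ineqs j).

Let height_pairing i j m :
  pairing m (\sum_(a < n) toReal K (gen (e i a)) -
             \sum_(a < n) toReal K (gen (e j a))) -
  (\sum_(a < n) (D (e j a))%:~R - \sum_(a < n) (D (e i a))%:~R) =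
  height (e i) m - height (e j) m.
Proof. by rewrite !heightE pairingC pairingBl !(pairingC _ m); ring. Qed.

Lemma cellP j m : cell j m <->
  divisor_polytope K D m /\ forall i, height (e j) m <= height (e i) m.
Proof.
split=> [mj|[mP mh] h].
  split=> [r|i].
    apply: (mj (toReal K (gen r), - (D r)%:~R)); rewrite mem_cat; apply/orP; left.
    by apply/mapP; exists r; rewrite ?mem_enum.
  have [->//|ij] := eqVneq i j.
  rewrite -subr_ge0 -height_pairing subr_ge0; apply: (mj (_, _)).
  rewrite mem_cat; apply/orP; right; apply/mapP; exists i => //.
  by rewrite mem_filter ij mem_enum.
rewrite mem_cat => /orP[/mapP[r _ ->]|/mapP[i _ ->]]; first exact: mP.
by rewrite -subr_ge0 height_pairing subr_ge0.
Qed.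

Lemma cell_strictP j m : (forall h, h \in cell_ineqs j -> h.2 < pairing m h.1) <->
  (forall r, - (D r)%:~R < pairing m (toReal K (gen r))) /\
  forall i, i != j -> height (e j) m < height (e i) m.
Proof.
split=> [mj|[mP mh] h].
  split=> [r|i ij].
    apply: (mj (toReal K (gen r), - (D r)%:~R)); rewrite mem_cat; apply/orP; left.
    by apply/mapP; exists r; rewrite ?mem_enum.
  rewrite -subr_gt0 -height_pairing subr_gt0; apply: (mj (_, _)).
  rewrite mem_cat; apply/orP; right; apply/mapP; exists i => //.
  by rewrite mem_filter ij mem_enum.
rewrite mem_cat => /orP[/mapP[r _ ->]|/mapP[i + ->]]; first exact: mP.
rewrite mem_filter => /andP[ij _].
by rewrite -subr_gt0 height_pairing subr_gt0 mh.
Qed.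

Lemma polytope_cell j : polytope (cell j).
Proof.
split; last by exists (cell_ineqs j).
have [M [Mr MP]] := bounded_polytope.
by exists M; split=> // x Mx m /cellP[mP _]; exact: MP Mx m mP.
Qed.

Lemma bigcup_cell : (0 < R)%N -> \bigcup_j cell j = divisor_polytope K D.
Proof.
move=> R0; apply/seteqP; split=> [m [j _ /cellP[]//]|m mP].
(* A point of P lies in the cell of any index minimising its height. *)
case: (@arg_minP _ _ _ (Ordinal R0) xpredT (fun i => height (e i) m)) => // j _ jm.
by exists j => //; apply/cellP; split=> // i; exact: jm.
Qed.

Lemma heightD t i x y : height (e i) (x + t *: (y - x)) =
  height (e i) x + t * (height (e i) y - height (e i) x).
Proof. by rewrite !heightE pairingDl pairingZl pairingBl; ring. Qed.

Lemma mdeg_local_monomial k (i : chart F) (m : 'rV[int]_n) :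
  (forall a, 0 <= vanishing_order D k i m a) ->
  Posz (mpoly.mdeg (local_monomial D k i m)) = \sum_(a < n) vanishing_order D k i m a.
Proof.
move=> m0; rewrite mpoly.mdegE (big_morph Posz PoszD (erefl (Posz 0))).
by apply: eq_bigr => a _; rewrite local_monomialE.
Qed.

Lemma phi_lattice_exponent k (i : chart F) (m : 'rV[int]_n) : (0 < k)%N ->
  (forall a, 0 <= vanishing_order D k i m a) ->
  phi D i (k%:R^-1 *: toReal K m) = k%:R^-1 *: exponent K (local_monomial D k i m).
Proof.
move=> k0 m0; rewrite phi_lattice//; congr (_ *: _); apply/rowP => a.
by rewrite !mxE -local_monomialE.
Qed.

(** The character of the lowest term at [j] occurs in [s] in every chart, so its exponent at [i] is
    at least the valuation at [i], which exceeds the one at [j]. Deglex turns this into an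
    inequality of degrees, that is, of heights. *)
Lemma valuation_in_cell k j s : (0 < k)%N -> Vset K D e k j s ->
  exists2 x, cell j x &
    phi D (e j) x = k%:R^-1 *: exponent K (valuation (e j) s).
Proof.
move=> k0 [sD [c sc] sv].
have sj i : s i != 0 by exact: (section_neq0 gens_unit i sD sc).
pose m := global_exponent D k (e j) (valuation (e j) s).
have sm := valuation_coef gens_unit sD (sj (e j)).
have m0 i a : 0 <= vanishing_order D k i m a.
  by move: sm; rewrite (coef_chart gens_unit _ i _ sD) => /coef_neq0[].
exists (k%:R^-1 *: toReal K m); last first.
  by rewrite phi_lattice_exponent// global_exponentK.
apply/cellP; split=> [r|i].
  rewrite -subr_ge0 opprK pairing_lattice// mulr_ge0 ?invr_ge0// ler0z.
  by have [i [a ->]] := exists_chart_ray r; exact: m0.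
rewrite !height_lattice// ler_wpM2l ?invr_ge0// ler_int -!mdeg_local_monomial//.
have [->//|ij] := eqVneq i j.
rewrite lez_nat; apply: mpoly.lemc_mdeg; rewrite global_exponentK//.
apply: (le_trans (ltW (sv i ij))); apply: mpoly.mlast_lemc.
move: sm; rewrite (coef_chart gens_unit _ (e i) _ sD).
by move=> /coef_neq0[].
Qed.

(** The section is chi^m: strictly smaller height means strictly smaller degree, which decides the
    deglex order. *)
Lemma lattice_point_valuation k j (m : 'rV[int]_n) : (0 < k)%N ->
  (forall h, h \in cell_ineqs j -> h.2 < pairing (k%:R^-1 *: toReal K m) h.1) ->
  exists2 s, Vset K D e k j s &
    k%:R^-1 *: exponent K (valuation (e j) s) = phi D (e j) (k%:R^-1 *: toReal K m).
Proof.
move=> k0 /cell_strictP[mP mh].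
have ik0 : 0 < k%:R^-1 :> K by rewrite invr_gt0 ltr0n.
have m0 r : 0 <= pairing m (gen r) + D r *+ k.
  have := mP r; rewrite -subr_gt0 opprK pairing_lattice// pmulr_rgt0//.
  by rewrite ltr0z => /ltW.
have m0' i a : 0 <= vanishing_order D k i m a by exact: m0.
exists (monomial_section K D k m); last first.
  by rewrite valuation_monomial phi_lattice_exponent.
split; first exact: monomial_sectionP.
  by exists (e j); rewrite -mpoly.msupp_eq0 mpoly.msuppX.
move=> i ij; rewrite !valuation_monomial; apply: mpoly.lt_mdeg_ltmc.
rewrite -ltz_nat !mdeg_local_monomial//.
by have := mh i ij; rewrite !height_lattice// ltr_pM2l// ltr_int.
Qed.

(** The map is an affine bijection, so the image is the polyhedron [H] whose inequalities are those
    of the cell composed with [phi_inv]. *)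
Lemma closed_phi_cell j : closed (phi D (e j) @` cell j).
Proof.
pose H := [seq (\row_(a < n) pairing (toReal K (dual_gen (e j) a)) h.1,
  h.2 - pairing (toReal K (vertex D (e j))) h.1) | h : 'rV[K]_n * K <- cell_ineqs j].
suff -> : phi D (e j) @` cell j = polyhedron H by exact: closed_polyhedron.
have pairing_phi_inv y (h : 'rV[K]_n) : pairing (phi_inv (e j) y) h =
    pairing (toReal K (vertex D (e j))) h +
    pairing y (\row_(a < n) pairing (toReal K (dual_gen (e j) a)) h).
  rewrite pairingDl pairing_suml; congr (_ + _); apply: eq_bigr => a _.
  by rewrite pairingZl mxE.
apply/seteqP; split=> [_ [x xj <-] _ /mapP[h hj ->]|y yH] /=.
  by rewrite lerBlDl -pairing_phi_inv phiK; exact: xj.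
exists (phi_inv (e j) y); last exact: phi_invK.
move=> h hj; rewrite pairing_phi_inv -lerBlDl.
by apply: (yH (_, _)); apply/mapP; exists h.
Qed.

Lemma phi_close i x eps : 0 < eps -> exists2 delta, 0 < delta &
  forall y, coord_close x y delta -> coord_close (phi D i x) (phi D i y) eps.
Proof.
move=> eps0; pose g a := \sum_l `|toReal K (gen (i a)) 0 l|.
have g0 a : 0 <= g a by exact: sumr_ge0.
exists (eps / (1 + \sum_a `|g a|)); first exact: div_sum_norm_gt0.
move=> y xy a; rewrite !phiE opprD addrACA subrr addr0.
apply: le_lt_trans (ler_pairing _ xy) _.
apply: le_lt_trans (mul_sum_norm_lt (index_enum 'I_n) g eps0).
apply: ler_wpM2l; first exact/ltW/div_sum_norm_gt0.
by rewrite [leRHS](bigD1 a)//= ger0_norm// lerDl sumr_ge0.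
Qed.

Hypothesis vertex_neq : forall i j, i != j -> vertex D (e i) != vertex D (e j).
Hypothesis ampleD : ample K D.

Lemma height_vertex_gt0 i j : i != j ->
  0 < height (e i) (toReal K (vertex D (e j))).
Proof.
move=> ij; have [k k0 kD] := ampleD; apply: vertex_gt0.
  by rewrite vertex_neq// eq_sym.
exact: vertex_in_polytope kD.
Qed.

(** At x_j the height at [j] is 0 and the others are positive, so the comparisons are strict there;
    a short move towards an interior point of P makes the remaining inequalities strict too. *)
Lemma exists_strict_point j :
  exists x, forall h, h \in cell_ineqs j -> h.2 < pairing x h.1.
Proof.
have [k k0 kD] := ampleD; have [y yP] := interior_polytope (e j) k0 kD.
pose x := toReal K (vertex D (e j)).
have xP : divisor_polytope K D x by exact: vertex_in_polytope kD.
have [|T T0 xyT] := @strict_segment _ _ (cell_ineqs j) x y; last first.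
  exists (x + (T / 2) *: (y - x)); apply: xyT; lra.
move=> h; rewrite mem_cat => /orP[/mapP[r _ ->]|/mapP[i + ->]].
  by right; split; [exact: xP|exact: yP].
rewrite mem_filter => /andP[ij _]; left.
by rewrite -subr_gt0 height_pairing height_vertex subr0 height_vertex_gt0.
Qed.

Lemma phi_cell j : phi D (e j) @` cell j = okounkov_body K D e j.
Proof.
apply/seteqP; split; last first.
  have /closure_id -> := @closed_phi_cell j; apply: closure_subset.
  move=> _ [k /= k0 [s sV <-]]; have [x xj xs] := valuation_in_cell k0 sV.
  by exists x.
(* Near a point of the cell there is a strict point m/N, whose image is 1/N times the valuation of
   the section chi^m of O(ND). *)
move=> _ [x xj <-] B /nbhs_close[eps eps0 epsB].
have [delta delta0 xdelta] := phi_close (e j) x eps0.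
have [y yj] := exists_strict_point j.
have [N [m [N0 xm mj]]] := lattice_dense xj yj delta0.
have [s sV sm] := lattice_point_valuation N0 mj.
exists (phi D (e j) (N%:R^-1 *: toReal K m)); split.
  by exists N => //; exists s.
by apply: epsB; exact: xdelta.
Qed.

(** At a common interior point the two heights agree, and also slightly further towards x_i. Being
    affine they would agree at x_i, where one is 0 and the other positive. *)
Lemma interior_cells_disjoint i j : i != j ->
  interior (cell i) `&` interior (cell j) = set0.
Proof.
move=> ij; apply/seteqP; split=> // x [/nbhs_close[d d0 xi] /nbhs_close[d' d'0 xj]].
pose y := toReal K (vertex D (e i)).
have [T T0 xT] := segment_close x y d0.
have [T' T'0 xT'] := segment_close x y d'0.
have [t [t0 tT tT']] : exists t, [/\ 0 < t, t < T & t < T'].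
  have [TT'|TT'] := leP T T'; [exists (T / 2)|exists (T' / 2)]; split; lra.
have heightE z : cell i z -> cell j z -> height (e i) z = height (e j) z.
  by move=> /cellP[_ zi] /cellP[_ zj]; apply/le_anti; rewrite zi zj.
have close_refl (eps : K) : 0 < eps -> coord_close x x eps.
  by move=> ? l; rewrite subrr normr0.
have hx := heightE x (xi _ (close_refl _ d0)) (xj _ (close_refl _ d'0)).
have := heightE (x + t *: (y - x)).
rewrite !heightD hx height_vertex => /(_ _ _)/addrI/(mulfI (lt0r_neq0 t0))/addIr.
move=> h; have ji : j != i by rewrite eq_sym.
have := height_vertex_gt0 ji; rewrite -/y -h ?ltxx//.
  by apply: xi; apply: xT; rewrite t0.
by apply: xj; apply: xT'; rewrite t0.
Qed.

End Cells.
End Toric.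

Theorem theorem6p4 (K : realType) (n : nat) (F : fan n) (D : ray F -> int)
  (hF : smooth_complete_fan K F) (hD : ample K D)
  (R : nat) (hR : (0 < R <= #|maxcones F|)%N)
  (p : 'I_R -> {set ray F})
  (hp : forall j, p j \in maxcones F) (p_inj : injective p) :
  exists (P : 'I_R -> set 'rV[K]_n) (e : 'I_R -> chart F),
    [/\ (forall j, polytope (P j)),
        \bigcup_j P j = divisor_polytope K D,
        (forall i j, i != j -> interior (P i) `&` interior (P j) = set0),
        (forall j, chart_cone (e j) = p j) &
        (forall j, phi D (e j) @` P j = okounkov_body K D e j)].
Proof.
have [conesF _ _ _ _] := hF; have /andP[R0 _] := hR.
(* Any ordering of the rays of each cone serves as the flag. *)
have /choice[e eP] j : exists e : chart F, chart_cone e = p j.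
  exact: exists_chart (conesF _ (hp j)).
have vertex_neq i j : i != j -> vertex D (e i) != vertex D (e j).
  (* Equal vertices give inclusions of the cones both ways, hence the same fixed point. *)
  have [k k0 kD] := hD; apply: contraNneq => ij; apply/eqP/p_inj.
  rewrite -!eP; apply/eqP; rewrite finset.eqEsubset.
  by rewrite !(very_ample_vertex_inj hF kD).
exists (cell D e), e; split=> //.
- exact: polytope_cell.
- exact: bigcup_cell.
- by move=> i j ij; exact: interior_cells_disjoint.
- by move=> j; exact: phi_cell.
Qed.
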